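(* Let $\mathbb{F}_q$ be the finite field of order $q$, let $m_1,\dots,m_\ell$ be positive integers coprime to $q$, let $n=m_1+\cdots+m_\ell$, and let $\Lambda=(\lambda_1,\dots,\lambda_\ell)$ with all $\lambda_i\in\mathbb{F}_q\setminus\{0\}$. Suppose that $x^{m_1}-\lambda_1,\dots,x^{m_\ell}-\lambda_\ell$ are pairwise coprime polynomials in $\mathbb{F}_q[x]$. Let $\mathcal{C}=\langle a_1(x),\dots,a_\rho(x)\rangle$ be a $\rho$-generator $\Lambda$-multi-twisted code of length $n$ over $\mathbb{F}_q$, where $a_\kappa(x)=(a_{\kappa,1}(x),\dots,a_{\kappa,\ell}(x))$ for $1\le\kappa\le\rho$. Then $$\mathcal{C}^\perp=\langle H_1(x),H_2(x),\dots,H_\ell(x)\rangle$$ (the $\mathbb{F}_q[x]$-submodule of $V'$ generated by these elements), where $H_i(x)=(0,\dots,0,\overline{h_i(x)},0,\dots,0)\in V'$ has $\overline{h_i(x)}$ in the $i$-th coordinate and $$h_i(x)=\frac{x^{m_i}-\lambda_i}{\gcd(a_{1,i}(x),a_{2,i}(x),\dots,a_{\rho,i}(x),x^{m_i}-\lambda_i)}\qquad(1\le i\le\ell),$$ and $\overline{h_i(x)}=h_i(x^{-1})\in V_i'$ with $x^{-1}=\lambda_i x^{m_i-1}$ the inverse of $x$ in $V_i'$.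
   Context: Let $V=\prod_{i=1}^{\ell}V_i$ with $V_i=\mathbb{F}_q[x]/\langle x^{m_i}-\lambda_i\rangle$, and $V'=\prod_{i=1}^{\ell}V_i'$ with $V_i'=\mathbb{F}_q[x]/\langle x^{m_i}-\lambda_i^{-1}\rangle$, both $\mathbb{F}_q[x]$-modules. $\mathbb{F}_q^n$ is identified with $V$ (and likewise with $V'$) by sending $(a_{1,0},\dots,a_{1,m_1-1};\dots;a_{\ell,0},\dots,a_{\ell,m_\ell-1})$ to $(a_1(x),\dots,a_\ell(x))$ with $a_i(x)=\sum_{j=0}^{m_i-1}a_{i,j}x^j$. A $\Lambda$-multi-twisted code of length $n$ over $\mathbb{F}_q$ is an $\mathbb{F}_q[x]$-submodule of $V$. It is called a $\rho$-generator code if $\rho$ is the smallest positive integer such that there are $\rho$ codewords $a_1(x),\dots,a_\rho(x)\in\mathcal{C}$ generating $\mathcal{C}$ as an $\mathbb{F}_q[x]$-module; one writes $\mathcal{C}=\langle a_1(x),\dots,a_\rho(x)\rangle$. The dual code $\mathcal{C}^\perp$ is taken with respect to the standard inner product on $\mathbb{F}_q^n$; it is an $\mathbb{F}_q[x]$-submodule of $V'$. *)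

(* Defs.v *)
From HB Require Import structures.
From mathcomp Require Import all_boot all_order all_algebra all_field.
Set Implicit Arguments.
Unset Strict Implicit.
Unset Printing Implicit Defensive.
Import GRing.Theory.
Local Open Scope ring_scope.

Section MultiTwisted.

Variables (F : finFieldType) (l : nat).

Definition twist_poly (m : nat) (c : F) : {poly F} := 'X^m - c%:P.

(* [{poly %/ p}] is the quotient by [p] only when [p] is monic of positive
   degree; the two lemmas below show that [twist_poly m c] is so for [0 < m]. *)
Lemma twist_poly_monic m c : (0 < m)%N -> twist_poly m c \is monic.
Proof. by move=> m_gt0; rewrite monicE lead_coefXnsubC. Qed.

Lemma mk_monic_twist_poly m c :
  (0 < m)%N -> mk_monic (twist_poly m c) = twist_poly m c.
Proof.
move=> m_gt0.
by rewrite /mk_monic twist_poly_monic // size_XnsubC // ltnS m_gt0.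
Qed.

Lemma qX_expE m c : (0 < m)%N ->
  'qX ^+ m = c%:A :> {poly %/ twist_poly m c}.
Proof.
move=> m_gt0; rewrite /qpolyX -rmorphXn /= -[in RHS]in_qpoly1 -in_qpolyZ alg_polyC.
apply/eqP; rewrite -subr_eq0 -raddfB /= -/(twist_poly m c); apply/eqP/val_inj.
by rewrite /= mk_monic_twist_poly // Pdiv.RingMonic.rmodpp ?twist_poly_monic.
Qed.

Lemma qX_unitE m c : (0 < m)%N -> c != 0 ->
  ('qX : {poly %/ twist_poly m c}) \is a GRing.unit.
Proof.
move=> m_gt0 c_neq0; rewrite -(unitrX_pos _ m_gt0) qX_expE //.
by apply/unitrP; exists (c^-1)%:A;
  rewrite -!scalerAl !mul1r !scalerA mulVf ?mulfV ?scale1r.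
Qed.

Lemma qX_invE m c : (0 < m)%N -> c != 0 ->
  'qX^-1 = c^-1 *: 'qX ^+ m.-1 :> {poly %/ twist_poly m c}.
Proof.
move=> m_gt0 c_neq0; apply: (mulrI (qX_unitE m_gt0 c_neq0)).
rewrite mulrV ?qX_unitE // -scalerAr -exprS prednK // qX_expE //.
by rewrite scalerA mulVf // scale1r.
Qed.

Definition mt_space (m : 'I_l -> nat) (lam : 'I_l -> F) : predArgType :=
  {dffun forall i : 'I_l, {poly %/ twist_poly (m i) (lam i)}}.

Section Module.

Variables (m : 'I_l -> nat) (lam : 'I_l -> F).
Local Notation V := (mt_space m lam).
Implicit Types (u v w : V) (p q : {poly F}).

HB.instance Definition _ := Finite.on V.

Definition mt_fun v : forall i, {poly %/ twist_poly (m i) (lam i)} := fun i => v i.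
Coercion mt_fun : mt_space >-> Funclass.

Definition mt_mk (f : forall i, {poly %/ twist_poly (m i) (lam i)}) : V :=
  finfun f.

Lemma mt_mkE f i : mt_mk f i = f i.
Proof. by rewrite /mt_fun /mt_mk ffunE. Qed.

Lemma mt_spaceP u v : (forall i, u i = v i) <-> u = v.
Proof. by split=> [uv|-> //]; apply/ffunP. Qed.

Definition mt_zero : V := mt_mk (fun i => 0).
Definition mt_add u v : V := mt_mk (fun i => u i + v i).
Definition mt_opp u : V := mt_mk (fun i => - u i).
Definition mt_scale p u : V := mt_mk (fun i => in_qpoly _ p * u i).

Fact mt_addA : associative mt_add.
Proof. by move=> u v w; apply/mt_spaceP=> i; rewrite !mt_mkE addrA. Qed.
Fact mt_addC : commutative mt_add.
Proof. by move=> u v; apply/mt_spaceP=> i; rewrite !mt_mkE addrC. Qed.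
Fact mt_add0 : left_id mt_zero mt_add.
Proof. by move=> u; apply/mt_spaceP=> i; rewrite !mt_mkE add0r. Qed.
Fact mt_addN : left_inverse mt_zero mt_opp mt_add.
Proof. by move=> u; apply/mt_spaceP=> i; rewrite !mt_mkE addNr. Qed.

HB.instance Definition _ :=
  GRing.isZmodule.Build V mt_addA mt_addC mt_add0 mt_addN.

Fact mt_scaleA p q v : mt_scale p (mt_scale q v) = mt_scale (p * q) v.
Proof. by apply/mt_spaceP=> i; rewrite !mt_mkE in_qpolyM mulrA. Qed.
Fact mt_scale1 : left_id 1 mt_scale.
Proof. by move=> u; apply/mt_spaceP=> i; rewrite !mt_mkE in_qpoly1 mul1r. Qed.
Fact mt_scaleDr : right_distributive mt_scale +%R.
Proof. by move=> p u v; apply/mt_spaceP=> i; rewrite !mt_mkE mulrDr. Qed.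
Fact mt_scaleDl v : {morph mt_scale^~ v : p q / p + q}.
Proof. by move=> p q; apply/mt_spaceP=> i; rewrite !mt_mkE in_qpolyD mulrDl. Qed.

HB.instance Definition _ := GRing.Zmodule_isLmodule.Build {poly F} V
  mt_scaleA mt_scale1 mt_scaleDr mt_scaleDl.

(* The i-th block of the word holds the coefficients of degree 0, ..., m i - 1
   of the reduced representative of the i-th coordinate. *)
Definition mt_word v : 'rV[F]_(\sum_(i < l) m i) :=
  \mxrow_(i < l) poly_rV (v i : {poly F}).

Definition mt_code (C : {set V}) : Prop := submod_closed C.

Definition generated_by (C : {set V}) (r : nat) (a : 'I_r -> V) : Prop :=
  forall v, v \in C <-> exists p : 'I_r -> {poly F}, v = \sum_(k < r) p k *: a k.

Definition generator_code (rho : nat) (C : {set V}) : Prop :=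
  [/\ (0 < rho)%N,
      exists a : 'I_rho -> V, generated_by C a
    & forall r : nat, (0 < r)%N ->
        (exists a : 'I_r -> V, generated_by C a) -> (rho <= r)%N].

End Module.

Definition dotp (n : nat) (u v : 'rV[F]_n) : F := \sum_(j < n) u 0 j * v 0 j.

Definition dual_shift (lam : 'I_l -> F) : 'I_l -> F := fun i => (lam i)^-1.

Variables (m : 'I_l -> nat) (lam : 'I_l -> F).
Local Notation V := (mt_space m lam).
Local Notation V' := (mt_space m (dual_shift lam)).

Definition dual_code (C : {set V}) : {set V'} :=
  [set w : V' | [forall c in C, dotp (mt_word c) (mt_word w) == 0]].

(* [gcdp] is only determined up to a unit; this is the monic representative
   (0 when p = q = 0). *)
Definition monic_gcdp (p q : {poly F}) : {poly F} :=
  (lead_coef (gcdp p q))^-1 *: gcdp p q.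

Definition check_poly (r : nat) (a : 'I_r -> V) (i : 'I_l) : {poly F} :=
  twist_poly (m i) (lam i)
    %/ monic_gcdp (\big[@gcdp F/0]_(k < r) (a k i : {poly F}))
                  (twist_poly (m i) (lam i)).

(* Here 'qX^-1 = lam i *: 'qX ^+ (m i).-1, by [qX_invE] with c = (lam i)^-1. *)
Definition bar (i : 'I_l) (h : {poly F}) :
    {poly %/ twist_poly (m i) (dual_shift lam i)} :=
  horner_alg ('qX^-1) h.

Definition dual_generator (r : nat) (a : 'I_r -> V) (i : 'I_l) : V' :=
  mt_mk (fun j => if j == i then bar j (check_poly a j) else 0).

End MultiTwisted.

(* Main.v *)
(** Write [c(x)] for a block of a word of [V] and [w(x^-1)] (formally
    [qrev]) for the image in [F[x]/(x^m - lam)] of a block of a word of [V'],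
    that is, of an element of [F[x]/(x^m - lam^-1)].  Their standard inner product
    is the constant coefficient of [c(x) w(x^-1)], and the form
    [(u, z) |-> (u z)_0] is nondegenerate.  Since the moduli are pairwise
    coprime, multiplication by a Chinese remainder idempotent isolates each
    block of a codeword, so [w] lies in the dual iff [a_{k,i}(x) w_i(x^-1) = 0]
    for all [k] and [i].  This says that [x^{m_i} - lam_i] divides
    [a_{k,i} w_i(x^-1)] for all [k], that is, that [h_i] divides [w_i(x^-1)];
    replacing [x] by [x^-1] gives [w_i] as a multiple of [h_i(x^-1)]. *)

Require Import Defs.
From mathcomp Require Import all_boot all_order all_algebra all_field.
Import GRing.Theory.
Local Open Scope ring_scope.

Set Implicit Arguments.
Unset Strict Implicit.

(** * Evaluation, divisibility and gcds of polynomials *)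

Lemma horner_algZ (F : comNzRingType) (A : algType F) (x : A) b
    (p : {poly F}) :
  horner_alg x (b *: p) = b *: horner_alg x p.
Proof. by rewrite -mul_polyC rmorphM /= horner_algC mulr_algl. Qed.

Lemma horner_alg_comp (F : comNzRingType) (A : algType F) (x : A)
    (p q : {poly F}) :
  horner_alg x (p \Po q) = horner_alg (horner_alg x q) p.
Proof.
elim/poly_ind: p => [|p b IHp]; first by rewrite comp_poly0 !rmorph0.
by rewrite comp_poly_MXaddC !rmorphD !rmorphM /= IHp !horner_algX !horner_algC.
Qed.

Lemma horner_alg_qX (F : comNzRingType) (h p : {poly F}) :
  horner_alg ('qX : {poly %/ h}) p = in_qpoly h p.
Proof.
elim/poly_ind: p => [|p b IHp]; first by rewrite rmorph0 in_qpoly0.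
rewrite rmorphD rmorphM /= IHp horner_algX horner_algC in_qpolyD in_qpolyM.
by rewrite -alg_polyC in_qpolyZ in_qpoly1.
Qed.

Lemma in_qpoly_id (F : nzRingType) (h : {poly F}) (u : {poly %/ h}) :
  in_qpoly h u = u.
Proof. exact/val_inj/in_qpoly_small/size_mk_monic. Qed.

Lemma dvdp_mulr_gcd (F : fieldType) (f p q v : {poly F}) :
  f %| p * v -> f %| q * v -> f %| gcdp p q * v.
Proof. by move=> fp fq; rewrite (eqp_dvdr _ (mulp_gcdl _ _ _)) dvdp_gcd fp. Qed.

Lemma dvdp_mulr_biggcd (F : fieldType) (n : nat) (f v : {poly F})
    (p : 'I_n -> {poly F}) :
  (forall k, f %| p k * v) -> f %| (\big[@gcdp F/0]_(k < n) p k) * v.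
Proof.
move=> fp; elim/big_rec: _ => [|k q _ fq]; first by rewrite mul0r dvdp0.
exact: dvdp_mulr_gcd.
Qed.

Lemma biggcdp_dvd (F : fieldType) (n : nat) (p : 'I_n -> {poly F}) k :
  (\big[@gcdp F/0]_(k < n) p k) %| p k.
Proof.
have: k \in index_enum 'I_n by rewrite mem_index_enum.
elim: (index_enum _) => // i s IHs; rewrite inE big_cons => /predU1P[->|/IHs].
  exact: dvdp_gcdl.
exact/dvdp_trans/dvdp_gcdr.
Qed.

Lemma monic_gcdp_eqp (F : finFieldType) (p q : {poly F}) : gcdp p q != 0 ->
  monic_gcdp p q %= gcdp p q.
Proof. by move=> g0; rewrite eqp_scale // invr_eq0 lead_coef_eq0. Qed.

(** A Bezout relation between [f i] and the product of the other [f j] splits 1 into two summands;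
    the multiple of that product is the Chinese remainder idempotent. *)
Lemma coprimep_idempotent (F : fieldType) (n : nat) (f : 'I_n -> {poly F}) i :
  (forall j, i != j -> coprimep (f i) (f j)) ->
  exists2 e : {poly F}, f i %| e - 1 & forall j, j != i -> f j %| e.
Proof.
move=> cop.
have /Bezout_eq1_coprimepP[[u v] /= uv] :
    coprimep (f i) (\prod_(j | j != i) f j).
  elim/big_rec: _ => [|j q ji fq]; first exact: coprimep1.
  by rewrite coprimepMr cop // eq_sym.
exists (v * \prod_(j | j != i) f j) => [|j ji].
  by rewrite -[X in _ - X]uv opprD addrCA subrr addr0 -mulNr dvdp_mull.
by rewrite (bigD1 j) //= mulrCA dvdp_mulr.
Qed.

(** * The reversal of x into x^-1 between two twisted quotients *)

Section Reversal.

Variables (F : finFieldType) (m : nat).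
Hypothesis m_gt0 : (0 < m)%N.

Lemma in_qpoly_twist_eq0 (c : F) p :
  (in_qpoly (twist_poly m c) p == 0) = (twist_poly m c %| p).
Proof.
by rewrite -val_eqE /= mk_monic_twist_poly // -Pdiv.IdomainMonic.modpE
  ?twist_poly_monic.
Qed.

(** Taking a plain polynomial as argument makes this a ring morphism by construction; elements of
    the other quotient enter through their reduced representatives. *)
Definition qrev (c : F) (p : {poly F}) : {poly %/ twist_poly m c} :=
  horner_alg 'qX^-1 p.

Lemma qrevE c p : c != 0 ->
  qrev c p = in_qpoly (twist_poly m c) (p \Po (c^-1 *: 'X^(m.-1))).
Proof.
move=> c_neq0; rewrite -horner_alg_qX horner_alg_comp /qrev qX_invE //.
by rewrite horner_algZ rmorphXn /= horner_algX.
Qed.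

Lemma qX_small (c : F) k : (k < m)%N ->
  ('qX ^+ k : {poly %/ twist_poly m c}) = 'X^k :> {poly F}.
Proof.
move=> km; rewrite -rmorphXn /= -[RHS](@in_qpoly_small _ (twist_poly m c)) //.
by rewrite mk_monic_twist_poly // size_XnsubC // size_polyXn.
Qed.

(** The powers of x and those of x^-1 are dual bases for the constant coefficient form. *)
Lemma coef0_qX_quotient (c : F) i j : c != 0 -> (i < m)%N -> (j < m)%N ->
  ('qX ^+ i * 'qX^-1 ^+ j : {poly %/ twist_poly m c})`_0 = (i == j)%:R.
Proof.
move=> c_neq0 im jm; have qX_unit := qX_unitE m_gt0 c_neq0.
have [ij|ji] := ltnP i j; last first.
  rewrite -{1}(subnK ji) exprD exprVn mulrK ?unitrX // qX_small; last first.
    exact: leq_ltn_trans (leq_subr _ _) im.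
  by rewrite coefXn eq_sym subn_eq0 eqn_leq ji andbT.
(* Since x^m = c, the negative power x^(i-j) wraps around to an exponent strictly between 0 and m,
   so its constant coefficient vanishes. *)
have -> : 'qX ^+ i * 'qX^-1 ^+ j
    = c^-1 *: 'qX ^+ (m - (j - i)) :> {poly %/ twist_poly m c}.
  apply: (mulIr (unitrX (j - i) qX_unit)).
  rewrite -scalerAl -exprD subnK ?(leq_trans (leq_subr _ _) (ltnW jm)) //.
  rewrite qX_expE // scalerA mulVf // scale1r mulrAC -exprD subnKC 1?ltnW //.
  by rewrite exprVn mulrV ?unitrX.
rewrite poly_of_qpolyZ qX_small ?coefZ ?coefXn ?ltn_subrL ?subn_gt0 ?ij //.
rewrite eq_sym subn_eq0 leqNgt (leq_ltn_trans (leq_subr _ _) jm) mulr0.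
by rewrite ltn_eqF.
Qed.

Lemma poly_of_qpolyE (c : F) (u : {poly %/ twist_poly m c}) :
  u = \sum_(i < m) u`_i *: 'X^i :> {poly F}.
Proof.
have u_size : (size u <= m)%N.
  rewrite -ltnS -(size_XnsubC c m_gt0) -/(twist_poly m c).
  apply: leq_trans (size_mk_monic u) _.
  by rewrite mk_monic_twist_poly.
rewrite -poly_def; apply/polyP=> i; rewrite coef_poly; case: ltnP => // mi.
by rewrite nth_default // (leq_trans u_size).
Qed.

Section Inverse.

Variables c d : F.
(** This form is symmetric in [c] and [d], so the lemmas below serve for reversal in both
    directions. *)
Hypothesis cd1 : c * d = 1.

Let dc1 : d * c = 1.
Proof. by rewrite mulrC. Qed.

Let c_neq0 : c != 0.
Proof. by apply: contra_eq_neq cd1 => ->; rewrite mul0r eq_sym oner_eq0. Qed.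

Let d_neq0 : d != 0.
Proof. by apply: contra_eq_neq dc1 => ->; rewrite mul0r eq_sym oner_eq0. Qed.

Let d_inv : d^-1 = c.
Proof. by rewrite -[LHS]mulr1 -dc1 mulKf. Qed.

(** Modulo x^m - c, the m-th power of x^-1 is c^-1 = d, so x^-1 is a root of x^m - d and reversal
    factors through the other quotient. *)
Lemma qrev_dvd_eq0 p : twist_poly m d %| p -> qrev c p = 0.
Proof.
have c_unit : (c%:A : {poly %/ twist_poly m c}) \is a GRing.unit.
  by rewrite -qX_expE // unitrX // qX_unitE.
move=> /dvdpP[q ->]; rewrite /qrev rmorphM /= [X in _ * X](_ : _ = 0) ?mulr0 //.
rewrite /twist_poly rmorphB rmorphXn /= horner_algX horner_algC exprVn qX_expE //.
apply/eqP; rewrite subr_eq0; apply/eqP/(mulrI c_unit).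
by rewrite mulrV // -scalerAl mul1r scalerA cd1 scale1r.
Qed.

Lemma qrev_in_qpoly p : qrev c (in_qpoly (twist_poly m d) p) = qrev c p.
Proof.
apply/eqP; rewrite -subr_eq0 -[X in X == _]raddfB /= mk_monic_twist_poly //.
rewrite -/(qrev c _); apply/eqP/qrev_dvd_eq0.
rewrite -Pdiv.IdomainMonic.modpE ?twist_poly_monic //.
rewrite [X in _ - X](divp_eq p (twist_poly m d)) opprD addrCA subrr addr0.
by rewrite -mulNr dvdp_mull.
Qed.

Lemma qrevM (x y : {poly %/ twist_poly m d}) :
  qrev c (x * y : {poly %/ twist_poly m d}) = qrev c x * qrev c y.
Proof.
rewrite -[x in LHS]in_qpoly_id -[y in LHS]in_qpoly_id -in_qpolyM qrev_in_qpoly.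
exact: rmorphM.
Qed.

Lemma qrevK p : qrev c (qrev d p) = in_qpoly (twist_poly m c) p.
Proof.
rewrite (qrevE p d_neq0) qrev_in_qpoly /qrev horner_alg_comp -horner_alg_qX.
(* The lift c x^(m-1) of the inverse, evaluated at x^-1, gives c x^-(m-1), which is x because x^m =
   c. *)
congr (horner_alg _ _); rewrite d_inv horner_algZ rmorphXn /= horner_algX.
rewrite exprVn; apply: (mulIr (x := 'qX ^+ m.-1)).
  by rewrite unitrX // qX_unitE.
by rewrite -scalerAl mulVr ?unitrX ?qX_unitE // -exprS prednK // qX_expE.
Qed.

Lemma dot_qrev (u : {poly %/ twist_poly m c}) (w : {poly %/ twist_poly m d}) :
  \sum_(j < m) u`_j * w`_j = (u * qrev c w : {poly %/ twist_poly m c})`_0.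
Proof.
have uE : u = \sum_(i < m) u`_i *: 'qX ^+ i.
  rewrite -[LHS]in_qpoly_id {1}poly_of_qpolyE raddf_sum; apply: eq_bigr => i _.
  by rewrite /= in_qpolyZ rmorphXn.
have -> : qrev c w = \sum_(j < m) w`_j *: 'qX^-1 ^+ j.
  rewrite {1}poly_of_qpolyE /qrev rmorph_sum; apply: eq_bigr => j _.
  by rewrite /= horner_algZ rmorphXn /= horner_algX.
rewrite [in RHS]uE mulr_suml poly_of_qpoly_sum coef_sum; apply: eq_bigr => i _.
rewrite mulr_sumr poly_of_qpoly_sum coef_sum (bigD1 i) // big1 => [|j /andP[_ ji]].
  rewrite -scalerAl -scalerAr !poly_of_qpolyZ !coefZ coef0_qX_quotient //.
  by rewrite eqxx mulr1 /= addr0.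
rewrite -scalerAl -scalerAr !poly_of_qpolyZ !coefZ coef0_qX_quotient //.
by rewrite eq_sym (negPf ji : (j == i :> nat) = false) !mulr0.
Qed.

Lemma coef0_nondegenerate (z : {poly %/ twist_poly m c}) :
  (forall p, (in_qpoly (twist_poly m c) p * z)`_0 = 0) -> z = 0.
Proof.
move=> z0; apply/val_inj; rewrite /= [LHS]poly_of_qpolyE big1 // => i _.
suff -> : z`_i = 0 by rewrite scale0r.
(* Testing against x^-i, written as the reversal of x^i, extracts the coefficient of [z] in degree
   [i]. *)
have := z0 (qrev c ('qX ^+ i : {poly %/ twist_poly m d})).
rewrite in_qpoly_id mulrC -dot_qrev (bigD1 i) //= qX_small // coefXn eqxx mulr1.
rewrite big1 ?addr0 // => j ji.
by rewrite coefXn (negPf ji : (j == i :> nat) = false) mulr0.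
Qed.

End Inverse.

End Reversal.

Lemma dotp_mt_word (F : finFieldType) (l : nat) (m : 'I_l -> nat)
    (lam : 'I_l -> F) (c : mt_space m lam) (w : mt_space m (dual_shift lam)) :
    (forall i, 0 < m i)%N -> (forall i, lam i != 0) ->
  dotp (mt_word c) (mt_word w) = \sum_(i < l) (c i * qrev _ (lam i) (w i))`_0.
Proof.
move=> m_gt0 lam_neq0.
(* Written as a matrix product, the dot product splits along the blocks. *)
have -> : dotp (mt_word c) (mt_word w) = (mt_word c *m (mt_word w)^T) 0 0.
  by rewrite mxE; apply: eq_bigr => j _; rewrite [X in _ = _ * X]mxE.
rewrite /mt_word tr_mxrow mul_mxrow_mxcol summxE; apply: eq_bigr => i _.
rewrite -(dot_qrev (m_gt0 i) (mulfV (lam_neq0 i))).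
by rewrite mxE; apply: eq_bigr => j _; rewrite !mxE.
Qed.

(** * Coordinates of linear combinations *)

Section Combination.

Variables (F : finFieldType) (l : nat) (m : 'I_l -> nat) (lam : 'I_l -> F).
Local Notation V := (mt_space m lam).

Lemma mt_sumE (r : nat) (u : 'I_r -> V) i :
  mt_fun (\sum_k u k) i = \sum_k u k i.
Proof.
apply: (big_morph (fun v : V => v i)) => [v w|]; exact: mt_mkE.
Qed.

Lemma mt_combE (r : nat) (p : 'I_r -> {poly F}) (u : 'I_r -> V) i :
  mt_fun (\sum_k p k *: u k) i =
    \sum_k in_qpoly (twist_poly (m i) (lam i)) (p k) * u k i.
Proof. by rewrite mt_sumE; apply: eq_bigr => k _; exact: mt_mkE. Qed.

End Combination.

Section Space.

Variables (F : finFieldType) (l : nat) (m : 'I_l -> nat) (lam : 'I_l -> F).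
Local Notation V := (mt_space m lam).

Lemma mt_comb_dual_generatorE (r : nat) (a : 'I_r -> V) (p : 'I_l -> {poly F}) i :
  mt_fun (\sum_k p k *: dual_generator a k) i
    = in_qpoly (twist_poly (m i) (dual_shift lam i)) (p i)
      * bar m lam i (check_poly a i).
Proof.
rewrite mt_combE (bigD1 i) //= big1 => [|k ki]; first by rewrite addr0 mt_mkE eqxx.
by rewrite mt_mkE eq_sym (negPf ki) mulr0.
Qed.

Hypothesis m_gt0 : forall i, (0 < m i)%N.

(** * The check polynomial as generator of an annihilator *)

Section CheckPoly.

Variables (r : nat) (a : 'I_r -> V) (i : 'I_l).
Local Notation f := (twist_poly (m i) (lam i)).
Local Notation g := (\big[@gcdp F/0]_(k < r) (a k i : {poly F})).

Let f_neq0 : f != 0.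
Proof. by rewrite monic_neq0 ?twist_poly_monic. Qed.

Let gcd_eqp : monic_gcdp g f %= gcdp g f.
Proof. by rewrite monic_gcdp_eqp // gcdp_eq0 negb_and f_neq0 orbT. Qed.

Let check_polyK : check_poly a i * monic_gcdp g f = f.
Proof. by rewrite divpK // (eqp_dvdl _ gcd_eqp) dvdp_gcdr. Qed.

Lemma dvdp_mul_check_poly k : f %| (a k i : {poly F}) * check_poly a i.
Proof.
rewrite -[X in X %| _]check_polyK mulrC dvdp_mul2r; last first.
  by apply: contra_eq_neq check_polyK => ->; rewrite mul0r eq_sym.
rewrite (eqp_dvdl _ gcd_eqp) (dvdp_trans (dvdp_gcdl _ _)) //.
exact: (biggcdp_dvd (fun k => a k i : {poly F})).
Qed.

(** If [v] annihilates every [a k i] modulo f, it annihilates their gcd with f; cancelling this gcd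
    from f leaves [check_poly a i]. *)
Lemma check_poly_dvdp v :
  (forall k, f %| (a k i : {poly F}) * v) -> check_poly a i %| v.
Proof.
move=> fv.
have G_neq0 : monic_gcdp g f != 0.
  by apply: contra_eq_neq check_polyK => ->; rewrite mulr0 eq_sym.
rewrite -(dvdp_mul2r _ _ G_neq0) check_polyK mulrC.
rewrite (eqp_dvdr _ (eqp_mulr _ gcd_eqp)).
by apply: dvdp_mulr_gcd; [exact: dvdp_mulr_biggcd | exact: dvdp_mulr].
Qed.

End CheckPoly.

Hypothesis lam_neq0 : forall i, lam i != 0.
Hypothesis twist_coprime : forall i j, i != j ->
  coprimep (twist_poly (m i) (lam i)) (twist_poly (m j) (lam j)).

(** * Membership in the dual code and its generators *)

Variables (r : nat) (C : {set V}) (a : 'I_r -> V).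
Hypothesis C_gen : generated_by C a.

Lemma mem_dual_code (w : mt_space m (dual_shift lam)) :
  w \in dual_code C <->
  forall i k, a k i * qrev _ (lam i) (w i) = 0.
Proof.
rewrite inE; split=> [/forall_inP wC i k | aw0].
  apply: (coef0_nondegenerate (m_gt0 i) (mulfV (lam_neq0 i))) => p.
  (* The factor [e] turns [p *: a k] into a codeword supported on block [i], so its inner product
     with [w] reduces to one term. *)
  have [e e1 e0] := coprimep_idempotent (@twist_coprime i).
  have /wC : (e * p) *: a k \in C.
    apply/C_gen; exists (fun j => if j == k then e * p else 0).
    by rewrite (bigD1 k) //= eqxx big1 ?addr0 // => j /negPf->; rewrite scale0r.
  rewrite dotp_mt_word // (bigD1 i) // big1 => [|j /andP[_ ji]].
    rewrite [X in X == _]addr0 => /eqP; rewrite mt_mkE in_qpolyM.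
    have /eqP-> : in_qpoly (twist_poly (m i) (lam i)) e == 1.
      by rewrite -subr_eq0 -in_qpoly1 -raddfB in_qpoly_twist_eq0.
    by rewrite mul1r mulrA.
  have /eqP ej0 : in_qpoly (twist_poly (m j) (lam j)) e == 0.
    by rewrite in_qpoly_twist_eq0 ?e0.
  by rewrite mt_mkE in_qpolyM ej0 !mul0r coef0.
apply/forall_inP => c /C_gen[p ->]; rewrite dotp_mt_word // big1 // => i _.
rewrite mt_combE mulr_suml big1 ?coef0 // => k _.
by rewrite -mulrA aw0 mulr0.
Qed.

Lemma generated_by_dual_generator :
  generated_by (dual_code C) (dual_generator a).
Proof.
move=> w; split=> [/mem_dual_code aw0 | [p ->]].
  (* A polynomial lift of the reversal of [w i], on which divisibility can be tested. *)
  pose v i := w i \Po ((lam i)^-1 *: 'X^((m i).-1)).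
  have vE i : qrev _ (lam i) (w i) = in_qpoly (twist_poly (m i) (lam i)) (v i).
    exact: qrevE.
  have hv i : check_poly a i %| v i.
    apply: check_poly_dvdp => k; rewrite -in_qpoly_twist_eq0 //.
    by rewrite in_qpolyM in_qpoly_id -vE aw0.
  (* The coefficient is the reversed cofactor of [check_poly a i] in [v i]; its product with [bar]
     is the reversal of [v i], which is [w i]. *)
  exists (fun i => qrev (m i) (dual_shift lam i) (v i %/ check_poly a i)).
  apply/mt_spaceP => i; rewrite mt_comb_dual_generatorE in_qpoly_id.
  have lamVK : dual_shift lam i * lam i = 1 by rewrite mulVf.
  rewrite -[RHS]rmorphM /= divpK // -[LHS]in_qpoly_id.
  by rewrite -(qrevK (m_gt0 i) lamVK) vE qrev_in_qpoly.
(* Conversely, reversing coordinate [i] of a combination gives a multiple of [check_poly a i], which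
   annihilates [a k i]. *)
apply/mem_dual_code => i k; rewrite mt_comb_dual_generatorE.
have lamK : lam i * dual_shift lam i = 1 by rewrite mulfV.
rewrite (qrevM (m_gt0 i) lamK) [X in _ * X]mulrC mulrA.
rewrite (qrevK (m_gt0 i) lamK) -[a k i]in_qpoly_id -in_qpolyM.
have := dvdp_mul_check_poly a i k; rewrite -in_qpoly_twist_eq0 // => /eqP->.
by rewrite mul0r.
Qed.

End Space.

Unset Implicit Arguments.
Set Strict Implicit.

Theorem theorem5p2 (F : finFieldType) (l : nat) (m : 'I_l -> nat)
    (lam : 'I_l -> F) (rho : nat) (C : {set mt_space m lam})
    (a : 'I_rho -> mt_space m lam)
    (l_gt0 : (0 < l)%N)
    (m_gt0 : forall i, (0 < m i)%N)
    (m_coprime : forall i, coprime (m i) #|F|)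
    (lam_neq0 : forall i, lam i != 0)
    (twist_coprime : forall i j, i != j ->
       coprimep (twist_poly (m i) (lam i)) (twist_poly (m j) (lam j)))
    (C_code : mt_code C)
    (C_rho : generator_code rho C)
    (C_gen : generated_by C a) :
  generated_by (dual_code C) (dual_generator a).
Proof. exact: generated_by_dual_generator. Qed.
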